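(* Let $n\in\mathbb{N}$, $n\ge1$. The sensitivity of $BPM_n$ satisfies \[\mathrm{s}(BPM_n)\ge\begin{cases}\frac n2\left(\frac n2+1\right), & n\equiv 0\pmod 2,\\[2pt] \left(\frac{n-1}{2}+1\right)^2, & n\equiv1\pmod 2.\end{cases}\]
   Context: $BPM_n:\{0,1\}^{n^2}\to\{0,1\}$ outputs 1 iff the bipartite graph $\{(a_i,b_j):x_{i,j}=1\}\subseteq K_{n,n}$ has a perfect matching. For a Boolean function $f$ on $\{0,1\}^N$ and $x\in\{0,1\}^N$, $\mathrm{s}_x(f)$ is the number of coordinates $i$ such that flipping the $i$-th bit of $x$ changes the value of $f$, and the sensitivity is $\mathrm{s}(f)=\max_x \mathrm{s}_x(f)$. *)

(* Defs.v *)
From mathcomp Require Import all_boot.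

Set Implicit Arguments.
Unset Strict Implicit.
Unset Printing Implicit Defensive.

Section Sensitivity.
Variable I : finType.
Implicit Types (f : {ffun I -> bool} -> bool) (x : {ffun I -> bool}).

Definition flip x (i : I) : {ffun I -> bool} :=
  [ffun j => if j == i then ~~ x j else x j].

Definition sensitivity_at f x : nat := #|[set i | f (flip x i) != f x]|.

Definition sensitivity f : nat := \max_(x : {ffun I -> bool}) sensitivity_at f x.

End Sensitivity.

(* Edges of K_{n,n} are pairs (i, j), standing for the edge {a_i, b_j}. *)
Definition edges n (x : {ffun 'I_n * 'I_n -> bool}) : {set 'I_n * 'I_n} :=
  [set e | x e].

(* Every left vertex a_i and every right vertex b_j lies on exactly one edge
   of M. *)
Definition perfect_matching n (M : {set 'I_n * 'I_n}) : bool :=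
  [forall i, #|[set e in M | e.1 == i]| == 1] &&
  [forall j, #|[set e in M | e.2 == j]| == 1].

Definition BPM n (x : {ffun 'I_n * 'I_n -> bool}) : bool :=
  [exists M : {set 'I_n * 'I_n}, (M \subset edges x) && perfect_matching M].

(* Main.v *)
Require Import Defs.
From mathcomp Require Import all_boot zify.

(** For [p < n], delete from [K_{n,n}] all edges between the [p + 1] left
    vertices [a_0, ..., a_p] and the [n - p] right vertices
    [b_p, ..., b_(n-1)].  The remaining graph violates Hall's condition, but
    restoring any single deleted edge creates a perfect matching, so the
    sensitivity is at least [(p + 1) * (n - p)]; take [p = (n - 1) %/ 2]. *)

Lemma card_ord_lt n p : p <= n -> #|[set i : 'I_n | i < p]| = p.
Proof.
by move=> le_pn; rewrite -sum1dep_card (big_ord_narrow le_pn) sum1_card card_ord.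
Qed.

Lemma BPM_of_injective n (x : {ffun 'I_n * 'I_n -> bool}) (f : 'I_n -> 'I_n) :
  injective f -> (forall i, x (i, f i)) -> BPM x.
Proof.
move=> f_inj xf; apply/existsP; exists [set e | e.2 == f e.1]; apply/and3P; split.
- by apply/subsetP=> -[i j]; rewrite !inE => /eqP /= ->.
- apply/forallP=> i; apply/cards1P; exists (i, f i); apply/setP=> -[k j].
  by rewrite !inE xpair_eqE /= andbC; case: eqP => // ->.
(* An injective self-map of a finite set is bijective; its inverse [g] gives the unique edge at
   [j]. *)
- apply/forallP=> j; have [g _ fK] := injF_bij f_inj.
  apply/cards1P; exists (g j, j); apply/setP=> -[i k].
  rewrite !inE xpair_eqE /= andbC [RHS]andbC; case: eqP => // ->.
  by rewrite -{1}(fK j) (inj_eq f_inj) eq_sym.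
Qed.

Lemma injective_of_BPM {n} {x : {ffun 'I_n * 'I_n -> bool}} :
  BPM x -> exists2 f : 'I_n -> 'I_n, injective f & forall i, x (i, f i).
Proof.
case/existsP=> M /and3P [/subsetP Mx /forallP rowM /forallP colM].
have exM i : exists j, (i, j) \in M.
  have /cards1P [[k j] /setP /(_ (k, j))] := rowM i.
  by rewrite !inE eqxx => /andP [Mkj /eqP /= ki]; exists j; rewrite -ki.
exists (fun i => xchoose (exM i)) => [i k eq_ik | i]; last first.
  by have /Mx := xchooseP (exM i); rewrite inE.
have Mi := xchooseP (exM i); have Mk := xchooseP (exM k).
(* The edges chosen for [i] and [k] end at the same right vertex, whose only edge in [M] is [e]. *)
have /cards1P [e /setP eqe] := colM (xchoose (exM i)).
have := eqe (i, xchoose (exM i)); rewrite !inE Mi eqxx => /esym /eqP ei.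
by have := eqe (k, xchoose (exM k)); rewrite !inE Mk eq_ik eqxx -ei => /esym /eqP [].
Qed.

Definition hall_violator n p : {ffun 'I_n * 'I_n -> bool} :=
  [ffun e : 'I_n * 'I_n => (p < e.1) || (e.2 < p)].

(** The [p + 1] left vertices up to [p] have all their neighbours among the [p] right vertices below
    [p]. *)
Lemma BPM_hall_violator n p : p < n -> BPM (hall_violator n p) = false.
Proof.
move=> lt_pn; apply/negbTE/negP=> /injective_of_BPM [f f_inj xf].
have: #|f @: [set i : 'I_n | i < p.+1]| <= #|[set j : 'I_n | j < p]|.
  apply/subset_leq_card/subsetP=> _ /imsetP [i + ->].
  by have := xf i; rewrite ffunE !inE /=; lia.
by rewrite card_imset // !card_ord_lt ?ltnn // ltnW.
Qed.

Lemma ord_pred_subproof {n} (i : 'I_n) : i.-1 < n.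
Proof. exact: leq_ltn_trans (leq_pred i) (ltn_ord i). Qed.

(** The matching that will use the restored edge [(a, b)]: its other edges lie on the diagonal or
    just below it. *)
Definition cycle_down {n} (a b i : 'I_n) : 'I_n :=
  if i == a then b else
  if a < i <= b then Ordinal (ord_pred_subproof i) else i.

Lemma cycle_down_inj n (a b : 'I_n) : a <= b -> injective (cycle_down a b).
Proof.
move=> le_ab i k /(congr1 val); rewrite /cycle_down -!val_eqE => eq_ik.
by apply/val_inj; move: eq_ik => /=; do 4?case: ifP => /=; lia.
Qed.

(** Match along [cycle_down a b]. Row [a] takes the restored edge. If [i < a], column [i] is below
    [p]; if [i > b], then [p < i]; if [a < i <= b], either [p < i] or [i - 1 < p]. *)
Lemma BPM_flip_hall_violator n p (a b : 'I_n) :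
  a <= p -> p <= b -> BPM (flip (hall_violator n p) (a, b)).
Proof.
move=> le_ap le_pb.
apply: (BPM_of_injective _ _ _ (cycle_down_inj _ _ _ (leq_trans le_ap le_pb))) => i.
rewrite !ffunE xpair_eqE /cycle_down -!val_eqE /=.
by case: (boolP (i == a :> nat)) => ia /=; [|case: ifP => /=]; rewrite ?eqxx /=; lia.
Qed.

Lemma sensitivity_BPM_ge n p : p < n -> p.+1 * (n - p) <= sensitivity (@BPM n).
Proof.
move=> lt_pn; apply: leq_trans (leq_bigmax (hall_violator n p)).
have cardT : #|~: [set j : 'I_n | j < p]| = n - p.
  by rewrite cardsCs setCK card_ord card_ord_lt // ltnW.
rewrite -(card_ord_lt n p.+1 lt_pn) -cardT -cardsX.
apply/subset_leq_card/subsetP=> -[a b]; rewrite !inE /= -leqNgt => /andP [le_ap le_pb].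
by rewrite BPM_hall_violator // BPM_flip_hall_violator.
Qed.

Theorem theorem4p9 (n : nat) (hn : 1 <= n) :
  (n = 0 %[mod 2] -> n %/ 2 * (n %/ 2 + 1) <= sensitivity (@BPM n)) /\
  (n = 1 %[mod 2] -> ((n - 1) %/ 2 + 1) ^ 2 <= sensitivity (@BPM n)).
Proof.
have lt_pn : (n - 1) %/ 2 < n by lia.
(* With [p = (n - 1) %/ 2], the factors [p + 1] and [n - p] are [m] and [m + 1] for [n = 2m], and
   both [m + 1] for [n = 2m + 1]. *)
split=> n2; apply: leq_trans (sensitivity_BPM_ge _ _ lt_pn).
- by apply: leq_mul; lia.
- by rewrite expnS expn1; apply: leq_mul; lia.
Qed.
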